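(* In the setting described in the context, suppose that the assumptions ''Lyapunov Structure'', ''Spectral Gap'' and ''Two-Point Mixing'' hold. Let $\mu>0$, $\delta\in(0,1)$, $\beta_*\ge1$ be constants (which exist under these assumptions) such that for every $V=V_{\beta_*,\eta}$ with $\eta>0$ sufficiently small one has, uniformly over all $f_0\in H^{-\delta}(M)$ with $\int_M f_0\,dx=0$, all $n\ge0$ and all $u_0\in U$, $$\mathbf E\left[V(u_n)^{-1}\|f_n\|_{H^{-\delta}}^2\right]\lesssim V(u_0)e^{-2\mu n}\|f_0\|_{H^{-\delta}}^2\quad\text{and}\quad \mathbf E\|f_n\|_{H^{-\delta}}^q\lesssim_q V(u_0)^q e^{-q\mu n}\|f_0\|_{H^{-\delta}}^q\ \ \text{for all } q\in(0,2).$$ Then, for $V=V_{\beta_*,\eta}$ with $\eta$ suitably small, for every $f_0\in H^{-\delta}(M)$ with $\int_M f_0\,dx=0$ and every $u_0\in U$ there is a random constant $K=K(u_0,f_0)$ such that for all $n\ge0$ $$\|f_n\|_{H^{-\delta}}\lesssim K(u_0,f_0)\,e^{-\mu n/2}\,V(u_0)\,\|f_0\|_{H^{-\delta}},$$ and for every $q\in(0,2)$ there is $C_q<\infty$, independent of $f_0$ and $u_0$, with $\mathbf E K(u_0,f_0)^q\le C_q$. Here $u_n=\Phi^n_\omega(u_0)$ and $f_n=f_0\circ(\phi^n_{\omega,u_0})^{-1}$.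
   Context: **Setting.** $M$ is a smooth compact $d$-dimensional Riemannian manifold without boundary; $dx$ is the Riemannian volume, normalized to total mass $1$. $(\Omega,\mathscr F,\mathbf P)$ is a probability space with a $\mathbf P$-preserving map $\theta:\Omega\to\Omega$; $U$ is a Polish space with metric $d$; $\Phi^n_\omega:U\to U$ is a continuous random dynamical system over $\theta$ such that $u_n=\Phi^n_\omega(u)$ is a Feller Markov chain with a unique stationary probability measure $\mu_U$. The skew product is $\tau(\omega,u)=(\theta\omega,\Phi_\omega(u))$ on $\Omega\times U$, with invariant ergodic measure $\mathbf P\times\mu_U$. For each $(\omega,u)$, $\phi_{\omega,u}:M\to M$ is a volume-preserving $C^{k_0}$ diffeomorphism (fixed $k_0\ge 2$), depending measurably on $(\omega,u)$, and $$\phi^n_{\omega,u}=\phi_{\tau^{n-1}(\omega,u)}\circ\cdots\circ\phi_{\tau(\omega,u)}\circ\phi_{\omega,u},\qquad \phi^0_{\omega,u}=\mathrm{Id}.$$ The dynamics is Markovian: there is a filtration $(\mathcal F_n)$ to which $u_n,\phi^n_{\omega,u}$ are adapted, such that conditionally on $\mathcal F_n$ the pair $(\phi_{\tau^n(\omega,u)},u_{n+1})$ has the law of $(\phi_{\omega',u'},\Phi_{\omega'}(u'))$ (with $\omega'\sim\mathbf P$) evaluated at $u'=u_n$. $\mathbf E_u$ denotes expectation with $u_0=u$. For a distribution $f_0$ on $M$, $f_n=f_0\circ(\phi^n_{\omega,u_0})^{-1}$ is defined by duality, $\langle f_n,g\rangle=\langle f_0,g\circ\phi^n_{\omega,u_0}\rangle$,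 and $\int_M f_0\,dx:=\langle f_0,1\rangle$. $H^{s}(M)$ is the usual $L^2$-based Sobolev space. $A\lesssim B$ means $A\le CB$ with $C$ independent of $f_0,u_0,n,\omega$. **The quantity $\mathcal Q_k$.** Fix a finite atlas of smooth charts $\varkappa_\iota:U_\iota\to U_\iota'\subset\mathbb R^d$ of $M$ (smooth up to the boundary). For a $C^k$ diffeomorphism $\phi$ of $M$, $$\mathcal Q_k(\phi)=1+\sup_{\iota,\iota'}\sup_{1\le|\alpha|\le k}\max\Big\{\|\partial^\alpha(\varkappa_{\iota'}\circ\phi\circ\varkappa_\iota^{-1})\|_{L^\infty(\varkappa_\iota(U_\iota\cap\phi^{-1}(U_{\iota'})))},\ \|\partial^\alpha(\varkappa_{\iota'}\circ\phi^{-1}\circ\varkappa_\iota^{-1})\|_{L^\infty(\varkappa_\iota(U_\iota\cap\phi(U_{\iota'})))}\Big\},$$ with $\|\cdot\|_{L^\infty(\emptyset)}=0$. **Lyapunov functions.** $V:U\to[1,\infty)$ is a Lyapunov function for a Markov kernel $P$ if its sublevel sets are bounded and $PV\le\delta' V+K'$ for some $\delta'\in(0,1)$, $K'\ge0$. **Lyapunov Structure.** There are functions $V_{\beta,\eta}:U\to[1,\infty)$, $\beta\ge0$, $\eta\in(0,1)$, which for $\beta\ge 1$ are Lyapunov functions for $(u_n)$, with $V_{\beta,\eta}^a=V_{a\beta,a\eta}$ for all $a\in(0,1/\eta)$, and there is $a_*>1$ such that for all $\beta\ge1$, all integers $1\le k\le k_0$ and all $b\ge0$ there is $\beta(k,b)\ge\beta$,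 with $\beta(1,b)=\beta$, such that for all $\eta\in(0,1/a_* )$ and all $u\in U$ $$\mathbf E_u\Big[\big(\mathcal Q_k(\phi_{\omega,u})^b\,V_{\beta,\eta}(u_1)\big)^{a_*}\Big]\le C\,V_{\beta(k,b),\eta}(u),\qquad C=C(b,k,a_*,\beta,\eta).$$ **Projective and twisted semigroups.** $\check A_{\omega,u,x}=(D_x\phi_{\omega,u})^{-\top}:T_x^*M\to T^*_{\phi_{\omega,u}(x)}M$. $S^*M$ is the unit cosphere bundle. For $p\in\mathbb R$, $$\hat P^p\psi(u,x,v)=\mathbf E\big[|\check A_{\omega,u,x}v|^{-p}\,\psi(u_1,\phi_{\omega,u}(x),\check A_{\omega,u,x}v/|\check A_{\omega,u,x}v|)\big].$$ $\mathrm{Lip}_V(U\times S^*M)$ is the space of continuous $\psi$ with $$\|\psi\|_{\mathrm{Lip}_V}=\sup_z\frac{|\psi(z)|}{V(u)}+\sup_{z\ne z'}\frac{|\psi(z)-\psi(z')|}{(V(u)+V(u'))\,d(z,z')}<\infty,$$ where $z=(u,x,v)$, $z'=(u',x',v')$, $d(z,z')=d(u,u')+d_{S^*M}((x,v),(x',v'))$. The operators $\hat P^p$ are assumed bounded on $\mathrm{Lip}_V$. **Spectral Gap.** There is $p_0>0$ such that, for $V=V_{\beta,\eta}$ with any $\beta\ge 1$, $\eta\in(0,1)$: (i) for all $p\in[-p_0,p_0]$, $\hat P^p$ has a simple dominant eigenvalue $e^{-\Lambda(p)}$ on $\mathrm{Lip}_V$, and the rest of its spectrum lies in a ball $B(0,r)$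 with $r\in(0,e^{-\Lambda(p)})$; (ii) $\Lambda(p)>0$ for $p\in(0,p_0)$; (iii) with $\pi_p$ the rank-one spectral projector for $e^{-\Lambda(p)}$, $\psi_p=\pi_p\mathbf 1$ satisfies $\hat P^p\psi_p=e^{-\Lambda(p)}\psi_p$ and for each bounded $B\subset U$ there is $c_B>0$ with $\psi_p(u,x,v)>c_B$ for all $u\in B$, $(x,v)\in S^*M$. **Two-Point Mixing.** Let $\Delta\subset M\times M$ be the diagonal and $P^{(2)}$ the Markov semigroup of $(u_n,\phi^n_{\omega,u}(x),\phi^n_{\omega,u}(y))$ on $U\times\Delta^c$. For all sufficiently small $p>0$, all $\beta\ge1$ and all $\eta\in(0,1)$ there is a Lyapunov function $\mathcal V_p$ for this chain, bounded above and below by constant multiples of $(d(x,y)^{-p}\vee1)V_{\beta,\eta}(u)$, and $\gamma>0$ such that for all $n\ge0$, all $(u,x,y)\in U\times\Delta^c$ and all continuous $\varphi$ with $\|\varphi\|_{C_{\mathcal V_p}}:=\sup|\varphi|/\mathcal V_p<\infty$, $$\Big|(P^{(2)})^n\varphi(u,x,y)-\int_U\int_M\int_M\varphi\,d\mu_U\,dx\,dy\Big|\le C\,\mathcal V_p(u,x,y)\,\|\varphi\|_{C_{\mathcal V_p}}e^{-\gamma n}.$$ *)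

(* Defs.v *)
From HB Require Import structures.
From mathcomp Require Import all_boot all_order all_algebra.
From mathcomp Require Import all_classical all_reals all_analysis.
From mathcomp Require Import measurable_realfun.

Set Implicit Arguments.
Unset Strict Implicit.
Unset Printing Implicit Defensive.

Import Order.TTheory GRing.Theory Num.Theory.
Import numFieldNormedType.Exports.

Local Open Scope classical_set_scope.
Local Open Scope ring_scope.

Notation borel T := (g_sigma_algebraType (@open T)).

#[short(type="pcmetricType")]
HB.structure Definition PointedCompleteMetric (R : numDomainType) :=
  {U of Metric R U & Uniform_isComplete U & isPointed U}.

Section Preliminaries.
Context {R : realType}.

(* Supremum of a set of nonnegative quantities; the supremum of the empty set
   is 0, as in the convention for norms of functions on an empty domain. *)
Definition esup0 (S : set (\bar R)) : \bar R := ereal_sup (S `|` [set 0%E]).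

(* e ^ (-s) for e in [0, +oo], with (+oo) ^ (-s) = 0.  At e = 0 the value is 0
   (for s <> 0), which only matters where the other factor vanishes or where
   the point is excluded. *)
Definition inv_pow (s : R) (e : \bar R) : R :=
  if e is r%:E then r `^ (- s) else 0.

(* E X <= c for X : Om -> [0, +oo]; asserting such a bound includes the
   measurability of X, without which E X is not defined. *)
Definition E_le d (Om : measurableType d) (P : probability Om R)
    (X : Om -> \bar R) (c : \bar R) : Prop :=
  measurable_fun setT X /\ (\int[P]_w X w <= c)%E.

Fixpoint leb_int (n : nat) : ('rV[R]_n -> \bar R) -> \bar R :=
  match n with
  | 0%N => fun f => f 0
  | n'.+1 => fun f =>
      (\int[@lebesgue_measure R]_t leb_int (fun y => f (row_mx t%:M y)))%E
  end.

Section Ck.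
Context {n : nat} {W : normedModType R}.
Implicit Types (f : 'rV[R]_n -> W) (O : set 'rV[R]_n).

(* The multi-index alpha is encoded by a sequence of |alpha| directions. *)
Definition pderivs (s : seq 'I_n) f : 'rV[R]_n -> W :=
  foldr (fun j (h : 'rV[R]_n -> W) => fun y => 'D_(delta_mx 0 j) h y) f s.

(* For open O. *)
Definition Ck_on (k : nat) O f : Prop :=
  forall (s : seq 'I_n) (y : 'rV[R]_n), (size s <= k)%N -> O y ->
    {for y, continuous (pderivs s f)} /\
    ((size s < k)%N -> forall j, derivable (pderivs s f) y (delta_mx 0 j)).

Definition smooth_on O f : Prop := forall k, Ck_on k O f.

End Ck.

Definition qform n (A : 'M[R]_n) (v : 'rV[R]_n) : R := (v *m A *m v^T) 0 0.

End Preliminaries.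

(* A smooth compact Riemannian manifold without boundary, given by a finite
   atlas.  The sets [core i] form the fixed atlas U_i; that its charts are
   smooth up to the boundary is rendered by letting the i-th chart be defined
   on an open [dom i] containing the closure of [core i].  [chart i] and
   [param i] are inverse to each other between [dom i] and its image, and
   unconstrained elsewhere.  [at_ x] is a chart whose core contains x.
   Vectors are rows, so that [jacobian f y] acts on the right, and
   [metric i y] is the Gram matrix of the metric in the i-th chart. *)
Record closed_riemannian (R : realType) (d : nat) (M : ptopologicalType) := {
  chart_index : finType ;
  dom : chart_index -> set M ;
  core : chart_index -> set M ;
  chart : chart_index -> M -> 'rV[R]_d ;
  param : chart_index -> 'rV[R]_d -> M ;
  at_ : M -> chart_index ;
  metric : chart_index -> 'rV[R]_d -> 'M[R]_d ;
  manifold_compact : compact [set: M] ;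
  manifold_hausdorff : hausdorff_space M ;
  dom_open : forall i, open (dom i) ;
  core_open : forall i, open (core i) ;
  core_dom : forall i, closure (core i) `<=` dom i ;
  core_at : forall x, core (at_ x) x ;
  image_open : forall i, open (chart i @` dom i) ;
  chartK : forall i x, dom i x -> param i (chart i x) = x ;
  chart_continuous : forall i x, dom i x -> {for x, continuous (chart i)} ;
  param_continuous : forall i x, dom i x ->
    {for chart i x, continuous (param i)} ;
  transition_smooth : forall i j,
    smooth_on (chart i @` (dom i `&` dom j)) (chart j \o param i) ;
  metric_smooth : forall i, smooth_on (chart i @` dom i) (metric i) ;
  metric_sym : forall i x, dom i x ->
    (metric i (chart i x))^T = metric i (chart i x) ;
  metric_pos : forall i x v, dom i x -> v != 0 ->
    0 < qform (metric i (chart i x)) v ;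
  metric_change : forall i j x, dom i x -> dom j x ->
    let J := jacobian (chart j \o param i) (chart i x) in
    metric i (chart i x) = J *m metric j (chart j x) *m J^T
}.

Section Manifold.
Context {R : realType} {d : nat} {M : ptopologicalType}.
Variable G : closed_riemannian R d M.
Local Notation I := (chart_index G).

Definition is_normalized_volume (vol : probability (borel M) R) : Prop :=
  exists2 c : R, 0 < c & forall (i : I) (A : set (borel M)),
    measurable A -> A `<=` dom i ->
    vol A = (c%:E * leb_int (fun y =>
      (\1_(chart i @` A) y * Num.sqrt (\det (metric i y)))%:E))%E.

(* Ranging over all C^1 curves R -> M loses nothing with respect to piecewise
   C^1 curves on [0, 1]: velocities may vanish, so a corner can be passed, and
   the curve extended beyond its endpoints, after reparametrization. *)
Definition C1_curve (c : R -> M) : Prop :=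
  continuous c /\
  forall (t : R) (i : I), dom i (c t) ->
    derivable (chart i \o c) t 1 /\
    {for t, continuous (fun s => 'D_1 (chart i \o c) s)}.

Definition velocity (c : R -> M) (t : R) : 'rV[R]_d :=
  'D_1 (chart (at_ G (c t)) \o c) t.

Definition gram (x : M) : 'M[R]_d := metric (at_ G x) (chart (at_ G x) x).

Definition speed (c : R -> M) (t : R) : R :=
  Num.sqrt (qform (gram (c t)) (velocity c t)).

(* +oo for points in different connected components. *)
Definition rdist (x y : M) : \bar R :=
  ereal_inf [set (\int[@lebesgue_measure R]_(t in `[0%R, 1%R]) (speed c t)%:E)%E
            | c in [set c | [/\ C1_curve c, c 0 = x & c 1 = y]]].

(* A covector at x is given by its components in the chart [at_ x]; it pairs
   with the tangent vector w as w *m v^T. *)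
Definition conorm (x : M) (v : 'rV[R]_d) : R :=
  Num.sqrt (qform (invmx (gram x)) v).

Definition cosphere := {z : M * 'rV[R]_d | conorm z.1 z.2 == 1}.

Definition components (i : I) (x : M) (v : 'rV[R]_d) : 'rV[R]_d :=
  v *m (jacobian (chart (at_ G x) \o param i) (chart i x))^T.

Definition C1_cocurve (c : R -> M * 'rV[R]_d) : Prop :=
  C1_curve (fst \o c) /\
  forall (t : R) (i : I), dom i (c t).1 ->
    let v := fun s => components i (c s).1 (c s).2 in
    derivable v t 1 /\ {for t, continuous (fun s => 'D_1 v s)}.

Definition christoffel (i : I) (y : 'rV[R]_d) (l k j : 'I_d) : R :=
  2^-1 * \sum_(m < d) invmx (metric i y) l m *
    ('D_(delta_mx 0 k) (metric i) y j m + 'D_(delta_mx 0 j) (metric i) y k m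
     - 'D_(delta_mx 0 m) (metric i) y k j).

Definition covariant_derivative (c : R -> M * 'rV[R]_d) (t : R) : 'rV[R]_d :=
  let x := (c t).1 in let i := at_ G x in
  let dv := 'D_1 (fun s => components i (c s).1 (c s).2) t in
  let dx := velocity (fst \o c) t in
  \row_j (dv 0 j - \sum_(k < d) \sum_(l < d)
            christoffel i (chart i x) l k j * dx 0 k * (c t).2 0 l).

Definition sasaki_speed (c : R -> M * 'rV[R]_d) (t : R) : R :=
  Num.sqrt (speed (fst \o c) t ^+ 2 +
            conorm (c t).1 (covariant_derivative c t) ^+ 2).

(* Riemannian distance on the unit cosphere bundle for the restriction of the
   Sasaki metric of T^*M. *)
Definition cdist (z z' : cosphere) : \bar R :=
  ereal_inf [set (\int[@lebesgue_measure R]_(t in `[0%R, 1%R])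
                    (sasaki_speed c t)%:E)%E
            | c in [set c | [/\ C1_cocurve c,
                               (forall t, conorm (c t).1 (c t).2 = 1),
                               c 0 = val z & c 1 = val z']]].

Definition Ck_map (k : nat) (f : M -> M) : Prop :=
  continuous f /\
  forall i j : I, Ck_on k (chart i @` (dom i `&` f @^-1` dom j))
                         (chart j \o f \o param i).

Definition Ck_diffeo (k : nat) (f finv : M -> M) : Prop :=
  [/\ cancel f finv, cancel finv f, Ck_map k f & Ck_map k finv].

(* [finv] is the inverse of [f].  As the functions are continuous on open sets,
   their L^oo norms are suprema. *)
Definition Qk (k : nat) (f finv : M -> M) : \bar R :=
  (1 + esup0 [set e | exists (h : M -> M) (i j : I) (s : seq 'I_d) y,
         [/\ h = f \/ h = finv, (1 <= size s <= k)%N,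
             (chart i @` (core i `&` h @^-1` core j)) y &
             e = `|pderivs s (chart j \o h \o param i) y|%:E ]])%E.

Section Sobolev.
Variable vol : probability (borel M) R.

(* Squared Sobolev-Slobodeckij norm of H^s(M), 0 < s < 1. *)
Definition sobolev_norm2 (s : R) (g : M -> R) : \bar R :=
  (\int[vol]_x (g x ^+ 2)%:E +
   \int[vol]_x \int[vol]_y
     ((g x - g y) ^+ 2 * inv_pow (d%:R + 2 * s) (rdist x y))%:E)%E.

Definition in_H (s : R) (g : M -> R) : Prop :=
  measurable_fun setT (g : borel M -> R) /\ (sobolev_norm2 s g < +oo)%E.

(* H^{-s}(M) is the dual of H^s(M); an element is a functional f, g |-> <f, g>,
   of which only the values on H^s(M) are relevant. *)
Definition Hneg_norm (s : R) (f : (M -> R) -> R) : \bar R :=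
  esup0 [set `|f g|%:E | g in [set g | in_H s g /\ (sobolev_norm2 s g <= 1)%E]].

Definition in_Hneg (s : R) (f : (M -> R) -> R) : Prop :=
  (forall (a : R) (g h : M -> R), in_H s g -> in_H s h ->
     f (a *: g + h) = a * f g + f h) /\
  (Hneg_norm s f < +oo)%E.

End Sobolev.

(* f o phi^{-1}, defined by duality *)
Definition transport (f : (M -> R) -> R) (phi : M -> M) : (M -> R) -> R :=
  fun g => f (g \o phi).

End Manifold.

(* Spectral theory of an operator T on a real normed space, given as a subspace
   L of X with norm N.  Spectra are those of the complexification. *)
Section Operators.
Context {R : realType} {X : lmodType R}.
Implicit Types (L : set X) (N : X -> \bar R) (T pi : X -> X).

Definition bounded_op L N T : Prop :=
  [/\ (forall f, L f -> L (T f)),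
      (forall (a : R) f g, L f -> L g -> T (a *: f + g) = a *: T f + T g) &
      exists c : R, forall f, L f -> (N (T f) <= c%:E * N f)%E].

(* a + ib is in the resolvent set: (a + ib) (f + ig) - T (f + ig) = h + ik has
   a unique solution, depending boundedly on the right-hand side. *)
Definition in_resolvent L N T (a b : R) : Prop :=
  let eqn := fun f g h k =>
    [/\ L f, L g, a *: f - b *: g - T f = h & b *: f + a *: g - T g = k] in
  exists c : R, forall h k, L h -> L k ->
    exists f g, [/\ eqn f g h k,
      (forall f' g', eqn f' g' h k -> f' = f /\ g' = g) &
      (N f + N g <= c%:E * (N h + N k))%E].

(* The spectral projector of T for the isolated point lam of its spectrum. *)
Definition is_spectral_projector L N T (lam : R) pi : Prop :=
  [/\ bounded_op L N pi,
      (forall f, L f -> pi (pi f) = pi f),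
      (forall f, L f -> T (pi f) = pi (T f)),
      (forall a b : R, (a, b) <> (lam, 0) ->
         in_resolvent (L `&` [set f | pi f = f]) N T a b) &
      in_resolvent (L `&` [set f | pi f = 0]) N T lam 0].

Definition rank_one L pi : Prop :=
  exists e, [/\ L e, e <> 0, pi e = e &
                forall f, L f -> exists c : R, pi f = c *: e].

(* lam is an algebraically simple eigenvalue with spectral projector pi, and
   the rest of the spectrum lies in B(0, r) with r < lam. *)
Definition simple_dominant L N T (lam : R) pi : Prop :=
  [/\ is_spectral_projector L N T lam pi,
      rank_one L pi &
      exists r : R, 0 < r < lam /\
        forall a b : R, (a, b) <> (lam, 0) -> ~ in_resolvent L N T a b ->
          a ^+ 2 + b ^+ 2 < r ^+ 2].

End Operators.

Section Dynamics.
Context {R : realType} {d : nat} {M : ptopologicalType}.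
Variable G : closed_riemannian R d M.
Context {dO : measure_display} {Om : measurableType dO}.
Variable P : probability Om R.
Context {U : pcmetricType R}.
Variables (vol : probability (borel M) R) (muU : probability (borel U) R).
Variables (theta : Om -> Om) (Phi : Om -> U -> U).
(* phiinv w u is the inverse of phi w u *)
Variables (phi phiinv : Om -> U -> M -> M).
Variable k0 : nat.

Definition tau (z : Om * U) : Om * U := (theta z.1, Phi z.1 z.2).

Definition u_ (n : nat) (w : Om) (u : U) : U := (iter n tau (w, u)).2.

Fixpoint phi_ (n : nat) (w : Om) (u : U) : M -> M :=
  if n is n'.+1 then
    let z := iter n' tau (w, u) in phi z.1 z.2 \o phi_ n' w u
  else id.

Definition stationary (nu : probability (borel U) R) : Prop :=
  forall A : set (borel U), measurable A ->
    (\int[nu]_u P [set w | A (Phi w u)] = nu A)%E.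

(* Sigma-algebra on pairs (diffeomorphism, point of U); on C^k0
   diffeomorphisms the evaluations generate the Borel sets of the C^k0
   topology. *)
Definition pair_measurable : set (set ((M -> M) * U)) :=
  <<s [set E | (exists (x : M) (B : set (borel M)),
                  measurable B /\ E = [set z | B (z.1 x)]) \/
               (exists C : set (borel U),
                  measurable C /\ E = [set z | C z.2])] >>.

Record setting (F : nat -> set (set Om)) : Prop := {
  k0_ge2 : (2 <= k0)%N ;
  vol_riemannian : is_normalized_volume G vol ;
  theta_measurable : measurable_fun setT theta ;
  theta_preserving : forall A, measurable A -> P (theta @^-1` A) = P A ;
  U_separable : exists2 D : set U, countable D & dense D ;
  Phi_measurable : measurable_fun setT
    (fun z : Om * borel U => Phi z.1 z.2 : borel U) ;
  Phi_continuous : forall w, continuous (Phi w) ;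
  Phi_feller : forall f : U -> R, continuous f ->
    (exists c : R, forall u, `|f u| <= c) ->
    continuous (fun u : U => \int[P]_w f (Phi w u)) ;
  muU_stationary : stationary muU ;
  muU_unique : forall nu : probability (borel U) R, stationary nu ->
    forall A, measurable A -> nu A = muU A ;
  tau_invariant : forall A : set (Om * borel U), measurable A ->
    (P \x muU)%E (tau @^-1` A) = (P \x muU)%E A ;
  tau_ergodic : forall A : set (Om * borel U), measurable A ->
    tau @^-1` A = A -> (P \x muU)%E A = 0%E \/ (P \x muU)%E A = 1%E ;
  phi_measurable : forall x : M, measurable_fun setT
    (fun z : Om * borel U => phi z.1 z.2 x : borel M) ;
  phi_diffeo : forall w u, Ck_diffeo G k0 (phi w u) (phiinv w u) ;
  phi_volume : forall w u (A : set (borel M)), measurable A ->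
    vol (phi w u @^-1` A) = vol A ;
  filt_sigma : forall n, sigma_algebra setT (F n) ;
  filt_sub : forall n, F n `<=` measurable ;
  filt_mono : forall n, F n `<=` F n.+1 ;
  u_adapted : forall n u (B : set (borel U)), measurable B ->
    F n [set w | B (u_ n w u)] ;
  phi_adapted : forall n u x (B : set (borel M)), measurable B ->
    F n [set w | B (phi_ n w u x)] ;
  markov_property : forall n u A E, F n A -> pair_measurable E ->
    P (A `&` [set w | let z := iter n tau (w, u) in
                      E (phi z.1 z.2, u_ n.+1 w u)]) =
    (\int[P]_(w in A)
       P [set w' | E (phi w' (u_ n w u), Phi w' (u_ n w u))])%E
}.

(* V is a Lyapunov function for the Markov chain on the domain D of T, with
   one-step transition z |-> step w z, w ~ P; dist is the metric of T. *)
Definition is_lyapunov T (D : set T) (dist : T -> T -> \bar R)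
    (step : Om -> T -> T) (V : T -> R) : Prop :=
  [/\ (forall z, D z -> 1 <= V z),
      (forall r : R, exists c : R, forall z z', D z -> D z' ->
         V z <= r -> V z' <= r -> (dist z z' <= c%:E)%E) &
      exists del K : R, [/\ 0 < del < 1, 0 <= K &
        forall z, D z ->
          E_le P (fun w => (V (step w z))%:E) (del * V z + K)%:E]].

(* V beta eta stands for V_{beta,eta}. *)
Definition lyapunov_structure (V : R -> R -> U -> R) : Prop :=
  [/\ (forall beta eta u, 0 <= beta -> 0 < eta < 1 -> 1 <= V beta eta u),
      (forall beta eta, 1 <= beta -> 0 < eta < 1 ->
         is_lyapunov setT (fun u u' => (mdist u u')%:E) Phi (V beta eta)),
      (forall beta eta a u, 0 <= beta -> 0 < eta < 1 -> 0 < a < eta^-1 ->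
         V beta eta u `^ a = V (a * beta) (a * eta) u) &
      exists2 a : R, 1 < a &
        forall (beta : R) (k : nat) (b : R),
          1 <= beta -> (1 <= k <= k0)%N -> 0 <= b ->
          exists beta' : R, [/\ beta <= beta', (k = 1%N -> beta' = beta) &
            forall eta : R, 0 < eta < a^-1 ->
              exists C : R, forall u : U,
                E_le P (fun w =>
                   ((Qk G k (phi w u) (phiinv w u) `^ b *
                     (V beta eta (Phi w u))%:E) `^ a)%E)
                   (C * V beta' eta u)%:E]].

Definition coact (w : Om) (u : U) (x : M) (v : 'rV[R]_d) : 'rV[R]_d :=
  let y := phi w u x in
  v *m (invmx (jacobian (chart (at_ G y) \o phi w u \o param (at_ G x))
                        (chart (at_ G x) x)))^T.

Definition stretch (w : Om) (z : U * cosphere G) : R :=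
  let: (u, s) := z in
  conorm G (phi w u (val s).1) (coact w u (val s).1 (val s).2).

(* The argument of [insubd] always has unit norm, so its default value [z.2] is
   never used. *)
Definition proj_step (w : Om) (z : U * cosphere G) : U * cosphere G :=
  let: (u, s) := z in
  (Phi w u,
   insubd s (phi w u (val s).1,
             (stretch w z)^-1 *: coact w u (val s).1 (val s).2)).

Definition Phat_integrand (p : R) (psi : U * cosphere G -> R)
    (z : U * cosphere G) (w : Om) : R :=
  stretch w z `^ (- p) * psi (proj_step w z).

Definition Phat (p : R) (psi : U * cosphere G -> R) : U * cosphere G -> R :=
  fun z => \int[P]_w Phat_integrand p psi z w.

Definition zdist (z z' : U * cosphere G) : \bar R :=
  ((mdist z.1 z'.1)%:E + cdist z.2 z'.2)%E.

Definition lip_norm (V : U -> R) (psi : U * cosphere G -> R) : \bar R :=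
  (esup0 [set e | exists z, e = (`|psi z| / V z.1)%:E] +
   esup0 [set e | exists z z', z <> z' /\
           e = (`|psi z - psi z'| / (V z.1 + V z'.1) *
                inv_pow 1 (zdist z z'))%:E])%E.

Definition in_Lip (V : U -> R) : set (U * cosphere G -> R) :=
  [set psi | (forall z (e : R), 0 < e -> exists2 r : R, 0 < r &
                forall z', (zdist z z' < r%:E)%E -> `|psi z - psi z'| < e) /\
             (lip_norm V psi < +oo)%E].

Definition spectral_gap (V : R -> R -> U -> R) : Prop :=
  exists2 p0 : R, 0 < p0 &
  forall beta eta : R, 1 <= beta -> 0 < eta < 1 ->
  let Vf := V beta eta in
  exists Lam : R -> R,
  [/\ (forall p psi z, - p0 <= p <= p0 -> in_Lip Vf psi ->
         P.-integrable setT (EFin \o Phat_integrand p psi z)),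
      (forall p, - p0 <= p <= p0 ->
         bounded_op (in_Lip Vf) (lip_norm Vf) (Phat p)),
      (forall p, 0 < p < p0 -> 0 < Lam p) &
      forall p, - p0 <= p <= p0 ->
        let lam := expR (- Lam p) in
        exists pi : (U * cosphere G -> R) -> (U * cosphere G -> R),
        [/\ simple_dominant (in_Lip Vf) (lip_norm Vf) (Phat p) lam pi,
            Phat p (pi (cst 1)) = lam *: pi (cst 1) &
            forall B : set U,
              (exists r : R, forall u u', B u -> B u' -> mdist u u' <= r) ->
              exists2 c : R, 0 < c & forall z, B z.1 -> c < pi (cst 1) z]].

Definition off_diag : set (U * (M * M)) := [set z | z.2.1 <> z.2.2].

Definition step2 (w : Om) (z : U * (M * M)) : U * (M * M) :=
  (Phi w z.1, (phi w z.1 z.2.1, phi w z.1 z.2.2)).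

Definition chain2 (n : nat) (w : Om) (z : U * (M * M)) : U * (M * M) :=
  (u_ n w z.1, (phi_ n w z.1 z.2.1, phi_ n w z.1 z.2.2)).

Definition dist2 (z z' : U * (M * M)) : \bar R :=
  ((mdist z.1 z'.1)%:E + rdist G z.2.1 z'.2.1 + rdist G z.2.2 z'.2.2)%E.

Definition two_point_mixing (V : R -> R -> U -> R) : Prop :=
  exists2 p1 : R, 0 < p1 &
  forall p beta eta : R, 0 < p < p1 -> 1 <= beta -> 0 < eta < 1 ->
  exists (VV : U * (M * M) -> R) (gam C : R),
  [/\ is_lyapunov off_diag dist2 step2 VV,
      (exists c c' : R, 0 < c /\ forall z, off_diag z ->
         let W := Num.max (inv_pow p (rdist G z.2.1 z.2.2)) 1 *
                  V beta eta z.1 in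
         c * W <= VV z <= c' * W),
      0 < gam &
      forall (n : nat) (z : U * (M * M)) (f : U * (M * M) -> R),
        off_diag z -> {within off_diag, continuous f} ->
        let Nf := esup0 [set e | exists2 z', off_diag z' &
                                  e = (`|f z'| / VV z')%:E] in
        (Nf < +oo)%E ->
        P.-integrable setT (fun w => (f (chain2 n w z))%:E) /\
        (`| \int[P]_w f (chain2 n w z) -
            \int[muU]_u \int[vol]_x
              \int[vol]_(y in [set y : borel M | y <> x]) f (u, (x, y)) |%:E
         <= (C * VV z * expR (- (gam * n%:R)))%:E * Nf)%E].

Definition f_ (f0 : (M -> R) -> R) (n : nat) (w : Om) (u : U) :
    (M -> R) -> R :=
  transport f0 (phi_ n w u).

Definition mean_zero (delta : R) (f0 : (M -> R) -> R) : Prop :=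
  in_Hneg G vol delta f0 /\ f0 (cst 1) = 0.

Definition moment_bounds (mu delta : R) (V : U -> R) : Prop :=
  (exists C : R, forall f0 (n : nat) (u : U), mean_zero delta f0 ->
     E_le P (fun w =>
        (((V (u_ n w u))^-1)%:E *
         Hneg_norm G vol delta (f_ f0 n w u) ^+ 2)%E)
       ((C * V u * expR (- (2 * mu * n%:R)))%:E *
        Hneg_norm G vol delta f0 ^+ 2)%E) /\
  (forall q : R, 0 < q < 2 ->
   exists C : R, forall f0 (n : nat) (u : U), mean_zero delta f0 ->
     E_le P (fun w => (Hneg_norm G vol delta (f_ f0 n w u) `^ q)%E)
       ((C * V u `^ q * expR (- (q * mu * n%:R)))%:E *
        Hneg_norm G vol delta f0 `^ q)%E).

End Dynamics.

(* Main.v *)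
(** Take K to be the supremum over n of e^(mu n / 2) |f_n| / (V(u0) |f_0|),
    with |.| the H^(-delta) norm.  Since K^q is at most the sum of the q-th
    powers of these quotients, E K^q is bounded by the sum of the
    E |f_n|^q e^(q mu n / 2) / (V(u0) |f_0|)^q, which the assumed q-th moment
    decay makes geometric with ratio e^(- q mu / 2), for every q in (0, 2). *)
Require Import Defs.
From mathcomp Require Import all_boot all_order all_algebra.
From mathcomp Require Import all_classical all_reals all_analysis.
From mathcomp Require Import measurable_realfun.
From mathcomp Require Import ring.
Import Order.TTheory GRing.Theory Num.Theory.
Import numFieldNormedType.Exports.
Local Open Scope classical_set_scope.
Local Open Scope ring_scope.

Lemma le_poweR2r {R : realType} (r : R) (x y : \bar R) :
  0 <= r -> (0 <= x)%E -> (x <= y)%E -> (x `^ r <= y `^ r)%E.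
Proof.
move=> r_ge0 x_ge0 xy; apply: gt0_ler_poweR => //.
  by rewrite in_itv/= x_ge0 leey.
by rewrite in_itv/= leey (le_trans x_ge0 xy).
Qed.

Lemma nneseries_expR {R : realType} (c a : R) : 0 < a ->
  (\sum_(0 <= n <oo) (c * expR (- (a * n%:R)))%:E = (c / (1 - expR (- a)))%:E)%E.
Proof.
move=> a_gt0; apply/cvg_lim => //.
have -> : (fun n => \sum_(0 <= k < n) (c * expR (- (a * k%:R)))%:E)%E =
    EFin \o series (geometric c (expR (- a))).
  apply/funext => n /=; rewrite sumEFin; congr EFin.
  by apply: eq_bigr => k _; rewrite /= -mulNr expRM_natr.
apply: cvg_EFin; first by near=> n.
apply: cvg_geometric_series.
by rewrite ger0_norm ?expR_ge0// -expR0 ltr_expR oppr_lt0.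
Unshelve. all: by end_near. Qed.

Lemma measurable_fun_ereal_sup_range {R : realType} {d : measure_display}
    {T : measurableType d} (X : nat -> T -> \bar R) :
  (forall n, measurable_fun setT (X n)) ->
  measurable_fun setT (fun w => ereal_sup (range (X ^~ w))).
Proof.
move=> mX; rewrite [X in measurable_fun _ X](_ : _ = fun w => esups (X ^~ w) 0%N).
  exact: measurable_fun_esups.
apply/funext => w; rewrite /esups/=; congr ereal_sup.
by apply/seteqP; split=> _ [n _ <-]; exists n.
Qed.

(** Pointwise, each [X n w] is the [1/q]-th power of one term of the series of [q]-th powers, so the
    supremum is at most the [1/q]-th power of the whole sum. Raising to the power [q] and exchanging
    sum and integral by Tonelli gives the bound, for [q] below 1 as well as above. *)
Lemma integral_sup_poweR_le {R : realType} {dO : measure_display}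
    {T : measurableType dO} (mu : {measure set T -> \bar R})
    (X : nat -> T -> \bar R) (q : R) : 0 < q ->
  (forall n, measurable_fun setT (X n)) -> (forall n w, (0 <= X n w)%E) ->
  (\int[mu]_w (ereal_sup (range (X ^~ w)) `^ q) <=
   \sum_(0 <= n <oo) \int[mu]_w (X n w `^ q))%E.
Proof.
move=> q_gt0 mX X_ge0.
have mXq n : measurable_fun setT (fun w => X n w `^ q)%E.
  exact: measurableT_comp (measurable_poweR q) (mX n).
rewrite -integral_nneseries//; last by move=> *; exact: poweR_ge0.
apply: ge0_le_integral => //.
- by move=> *; exact: poweR_ge0.
- apply: measurableT_comp (measurable_poweR q) _.
  exact: measurable_fun_ereal_sup_range.
- apply: ge0_emeasurable_sum => //.
  by move=> *; exact: poweR_ge0.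
move=> w _; set S := (\sum_(0 <= n <oo) _)%E.
have S_ge0 : (0 <= S)%E by apply: nneseries_ge0 => *; exact: poweR_ge0.
have sup_ge0 : (0 <= ereal_sup (range (X ^~ w)))%E.
  by apply: le_trans (X_ge0 0%N w) _; apply: ereal_sup_ubound; exists 0%N.
(* Writing the sum as [(S^(1/q))^q] leaves the comparison of the supremum with [S^(1/q)], which can
   be made term by term. *)
rewrite -[leRHS]poweRe1// -(mulVf (lt0r_neq0 q_gt0)) poweRrM.
apply: le_poweR2r => //; first exact: ltW.
apply/ereal_supP => _ [n _ <-].
rewrite -[leLHS]poweRe1// -(mulfV (lt0r_neq0 q_gt0)) poweRrM.
apply: le_poweR2r; rewrite ?poweR_ge0 ?invr_ge0 ?(ltW q_gt0)//.
rewrite /S (nneseriesD1 (n := n))//; last by move=> *; exact: poweR_ge0.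
by rewrite leeDl//; apply: nneseries_ge0 => *; exact: poweR_ge0.
Qed.

(** The probabilistic core, with [Y n] in the role of the norm of [f_n] and [A] in that of [V(u0)]
    times the norm of [f_0]. Half of the decay rate is given up to make the moments of the weighted
    terms summable. The variable [K] is built without reference to [q], so one [K] serves all
    exponents. *)
Lemma exponential_decay_sup {R : realType} {dO : measure_display}
    {Om : measurableType dO} (P : probability Om R)
    (Y : nat -> Om -> \bar R) (m A : R) (C : R -> R) :
  0 < m -> 0 <= A -> (forall n w, (0 <= Y n w)%E) ->
  (forall q : R, 0 < q < 2 -> forall n,
     E_le P (fun w => Y n w `^ q)%E
       (C q * expR (- (q * m * n%:R)) * A `^ q)%:E) ->
  exists K : {RV P >-> R},
    [/\ (forall w, 0 <= K w),
        {ae P, forall w, forall n,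
           (Y n w <= (K w * expR (- (m * n%:R / 2)) * A)%:E)%E} &
        forall q : R, 0 < q < 2 ->
          E_le P (fun w => (K w `^ q)%:E)
            (`|C q| / (1 - expR (- (q * m / 2))))%:E].
Proof.
move=> m_gt0 A_ge0 Y_ge0 YC.
(* The exponent 1 is admissible; it yields measurability of [Y n] itself and, later, almost sure
   finiteness of the supremum. *)
have q1 : 0 < (1 : R) < 2 by rewrite ltr01 ltr1n.
have Y1 n : (fun w => Y n w `^ 1)%E = Y n.
  by apply/funext => w; rewrite poweRe1.
have mY n : measurable_fun setT (Y n) by have [] := YC _ q1 n; rewrite Y1.
have den_gt0 q : 0 < q -> 0 < 1 - expR (- (q * m / 2)).
  move=> q_gt0; rewrite subr_gt0 -expR0 ltr_expR oppr_lt0.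
  by rewrite divr_gt0 ?mulr_gt0.
have [A0|A_neq0] := eqVneq A 0.
  (* Dividing by [A] is impossible here, but the first moment of each [Y n] is then at most 0, so
     almost surely all [Y n] vanish and [K = 0] works. *)
  exists (cst 0); split => //.
  - apply: ae_foralln => n; have [_] := YC _ q1 n.
    rewrite Y1 A0 powRr1// mulr0 => intY.
    have : ae_eq P setT (Y n) (cst 0%E).
      apply/ae_eq_integral_abs => //; apply/eqP; rewrite eq_le integral_ge0// andbT.
      by rewrite (eq_integral (Y n))// => w _; rewrite gee0_abs.
    by apply: filterS => w ->//; rewrite mulr0.
  move=> q /andP[q_gt0 _]; split; first exact: (measurable_cst (EFin (powR 0 q))).
  rewrite integral0_eq => [|w _]; last by rewrite powR0// gt_eqF.
  by rewrite lee_fin divr_ge0// ltW// den_gt0.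
have A_gt0 : 0 < A by rewrite lt_neqAle eq_sym A_neq0.
pose a n : R := expR (m * n%:R / 2) / A.
have a_gt0 n : 0 < a n by rewrite divr_gt0 ?expR_gt0.
pose X n w := ((a n)%:E * Y n w)%E.
have X_ge0 n w : (0 <= X n w)%E by rewrite mule_ge0// lee_fin ltW.
have mX n : measurable_fun setT (X n) by exact: measurable_funeM.
pose S w := ereal_sup (range (X ^~ w)).
have XS n w : (X n w <= S w)%E by apply: ereal_sup_ubound; exists n.
have S_ge0 w : (0 <= S w)%E by exact: le_trans (XS 0%N w).
have mS : measurable_fun setT S by exact: measurable_fun_ereal_sup_range.
have intS q : 0 < q < 2 ->
    (\int[P]_w (S w `^ q) <= (`|C q| / (1 - expR (- (q * m / 2))))%:E)%E.
  move=> q02; have /andP[q_gt0 _] := q02.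
  apply: le_trans (integral_sup_poweR_le P _ _ q_gt0 mX X_ge0) _.
  rewrite -nneseries_expR ?divr_gt0 ?mulr_gt0//.
  apply: lee_nneseries => [n _ _|n _]; first by apply: integral_ge0 => *; exact: poweR_ge0.
  have [mYq intYq] := YC q q02 n.
  under eq_integral do rewrite /X poweRM// ?lee_fin ?ltW// poweR_EFin.
  rewrite ge0_integralZl_EFin ?powR_ge0//; last by move=> *; exact: poweR_ge0.
  (* No sign is assumed for [C q], hence the passage to its absolute value. *)
  apply: (@le_trans _ _ ((a n `^ q)%:E *
      (`|C q| * expR (- (q * m * n%:R)) * A `^ q)%:E)%E).
    rewrite lee_wpmul2l ?lee_fin ?powR_ge0//; apply: le_trans intYq _.
    by rewrite lee_fin !ler_wpM2r ?powR_ge0 ?expR_ge0// ler_norm.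
  rewrite -EFinM lee_fin [leLHS](_ : _ =
      `|C q| * (expR (- (q * m * n%:R)) * (a n * A) `^ q)); last first.
    by rewrite powRM ?(ltW (a_gt0 n))//; ring.
  (* Since [a n * A = expR (m * n / 2)], its [q]-th power absorbs half of the exponent in
     [expR (- (q * m * n))], leaving the general term of the geometric series. *)
  rewrite ler_wpM2l// /a divfK//.
  rewrite /powR gt_eqF ?expR_gt0// expRK -expRD ler_expR.
  by rewrite le_eqVlt; apply/orP; left; apply/eqP; field.
(* The moment bound with [q = 1] makes [S] integrable, hence almost surely finite. *)
have S_fin : {ae P, forall w, S w \is a fin_num}.
  have iS : P.-integrable setT S.
    apply/integrableP; split => //.
    under eq_integral do rewrite gee0_abs// -[S _]poweRe1//.
    by apply: le_lt_trans (intS _ q1) _; rewrite ltry.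
  have := integrable_ae measurableT iS.
  by apply: filterS => w; apply.
(* [fine] sends the value +oo, taken by S on a null set only, to 0. *)
have mK : measurable_fun setT (fine \o S) by exact: measurableT_comp.
pose K : {RV P >-> R} := mfun_Sub (mem_set mK).
exists K; split => [w||q q02].
- exact: fine_ge0.
- apply: filterS S_fin => w Sw n.
  have -> : Y n w = ((expR (- (m * n%:R / 2)) * A)%:E * X n w)%E.
    by rewrite /X muleA -EFinM mulrACA divff// mulr1 -expRD addNr expR0 mul1e.
  rewrite [leRHS](_ : _ = (expR (- (m * n%:R / 2)) * A)%:E * S w)%E; last first.
    by rewrite -(fineK Sw) -EFinM; congr EFin; rewrite -mulrA mulrC.
  by rewrite lee_pmul2l// lte_fin mulr_gt0// expR_gt0.
have mKq : measurable_fun setT (fun w => (K w `^ q)%:E).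
  by apply/measurable_EFinP; exact: measurableT_comp (measurable_powR q) mK.
split => //; apply: le_trans (intS q q02).
apply: ge0_le_integral => //.
- by move=> w _; rewrite lee_fin powR_ge0.
- exact: measurableT_comp (measurable_poweR q) mS.
(* [fine] never increases a nonnegative extended real, so the moments of [S] dominate those of
   [K]. *)
move=> w _; rewrite /= -fine_poweR.
by have := poweR_ge0 (S w) q; case: (S w `^ q)%E => //= *; rewrite leey.
Qed.

Theorem corollary1p13 (R : realType) (d : nat) (M : ptopologicalType)
  (G : closed_riemannian R d M)
  (dO : measure_display) (Om : measurableType dO) (P : probability Om R)
  (U : pcmetricType R)
  (vol : probability (borel M) R) (muU : probability (borel U) R)
  (theta : Om -> Om) (Phi : Om -> U -> U) (phi phiinv : Om -> U -> M -> M)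
  (k0 : nat) (F : nat -> set (set Om)) (V : R -> R -> U -> R)
  (mu delta betas : R)
  (Hset : setting G P vol muU theta Phi phi phiinv k0 F)
  (Hlyap : lyapunov_structure G P Phi phi phiinv k0 V)
  (Hgap : spectral_gap G P Phi phi V)
  (Hmix : two_point_mixing G P vol muU theta Phi phi V)
  (mu_gt0 : 0 < mu) (delta01 : 0 < delta < 1) (betas_ge1 : 1 <= betas)
  (Hmom : exists2 eta0 : R, 0 < eta0 & forall eta : R, 0 < eta < 1 ->
     eta < eta0 ->
     moment_bounds G P vol theta Phi phi mu delta (V betas eta)) :
  exists2 eta1 : R, 0 < eta1 & forall eta : R, 0 < eta < 1 -> eta < eta1 ->
  exists (C : R) (Cq : R -> R),
  forall (f0 : (M -> R) -> R) (u0 : U), mean_zero G vol delta f0 ->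
  exists K : {RV P >-> R},
    [/\ (forall w, 0 <= K w),
        {ae P, forall w, forall n : nat,
           (Hneg_norm G vol delta (f_ theta Phi phi f0 n w u0) <=
            (C * K w * expR (- (mu * n%:R / 2)) * V betas eta u0)%:E *
            Hneg_norm G vol delta f0)%E} &
        forall q : R, 0 < q < 2 ->
          E_le P (fun w => (K w `^ q)%:E) (Cq q)%:E].
Proof.
have [eta0 eta0_gt0 moments] := Hmom.
exists eta0 => // eta eta01 eta_lt; have [_ mom] := moments eta eta01 eta_lt.
have [V_ge1 _ _ _] := Hlyap.
set W := V betas eta in mom *.
have W_gt0 u : 0 < W u.
  apply: lt_le_trans ltr01 _; apply: V_ge1 => //.
  exact: le_trans ler01 betas_ge1.
pose H := Hneg_norm G vol delta.
have H_ge0 f : (0 <= H f)%E by apply: ereal_sup_ubound; right.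
(* The constants are chosen as a function of [q] before [f0] and [u0] are introduced, which makes
   the final moment bounds uniform in both. Outside the range of [q] the value 0 is a dummy. *)
have /choice[C CP] q : exists c : R, 0 < q < 2 -> forall f0 n u,
    mean_zero G vol delta f0 ->
    E_le P (fun w => H (f_ theta Phi phi f0 n w u) `^ q)%E
      ((c * W u `^ q * expR (- (q * mu * n%:R)))%:E * H f0 `^ q)%E.
  by have [/mom[c ?]|] := boolP (0 < q < 2); [exists c|exists 0].
exists 1, (fun q => `|C q| / (1 - expR (- (q * mu / 2)))) => f0 u0 f0P.
have [[_ Hf0_lty] _] := f0P.
(* Membership in [H^(-delta)] makes the norm of [f0] finite, so that [A] can be a real number. *)
have Hf0 : H f0 = (fine (H f0))%:E by rewrite fineK// ge0_fin_numE.
have Hf0_ge0 : 0 <= fine (H f0) by exact: fine_ge0.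
have [||q q02 n|K [K_ge0 K_bound K_moment]] := @exponential_decay_sup R dO Om P
    (fun n w => H (f_ theta Phi phi f0 n w u0)) mu (W u0 * fine (H f0)) C mu_gt0.
- by rewrite mulr_ge0// ltW.
- by [].
- have [mHq intHq] := CP q q02 f0 n u0 f0P; split => //.
  rewrite (le_trans intHq)// {1}Hf0 poweR_EFin -EFinM lee_fin powRM ?(ltW (W_gt0 _))//.
  by rewrite le_eqVlt; apply/orP; left; apply/eqP; ring.
exists K; split => //; apply: filterS K_bound => w Kw n.
by rewrite -/H [X in (_ * X)%E]Hf0 -EFinM mul1r -(mulrA _ (W u0)).
Qed.
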